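(* Let $\nu\ge 0$. The free multiplicative constants in the type 1 functions $q_{n,n}^{\alpha}$ and $q_{n,n-1}^{\alpha}$ (for all integers $n\ge 0$ and all real $\alpha>-1$) can be chosen, as nonzero constants, simultaneously in such a way that for every $\alpha>0$ and every integer $n\ge 0$, for all $x>0$, $$\frac{d}{dx}\left[x^{\alpha}q_{n,n}^{\alpha}(x)\right]=x^{\alpha-1}q_{n+1,n}^{\alpha-1}(x),\qquad \frac{d}{dx}\left[x^{\alpha}q_{n,n-1}^{\alpha}(x)\right]=x^{\alpha-1}q_{n,n}^{\alpha-1}(x).$$
   Context: $K_\nu$ is the Macdonald function (modified Bessel function of the second kind), given for $z>0$ by $K_\nu(z)=\frac12\left(\frac z2\right)^{\nu}\int_0^\infty \exp\left(-t-\frac{z^2}{4t}\right)t^{-\nu-1}\,dt$. For $x>0$ the scaled Macdonald function is $\rho_\nu(x)=2x^{\nu/2}K_\nu(2\sqrt{x})$. Throughout $\nu\ge 0$. For $\alpha>-1$ and indices $n\ge 0$, $m\in\{n,n-1\}$, the type 1 multiple orthogonal polynomials for the pair of weights $(\rho_\nu,\rho_{\nu+1})$ are a pair $(A_{n,m}^{\alpha},B_{n,m}^{\alpha})\neq(0,0)$ of polynomials of degrees (at most) $n$ and $m$ respectively such that $$\int_0^\infty\left[A_{n,m}^{\alpha}(x)\rho_\nu(x)+B_{n,m}^{\alpha}(x)\rho_{\nu+1}(x)\right]x^{k+\alpha}\,dx=0,\qquad k=0,1,2,\ldots,n+m.$$ For these indices the pair is unique up to a common nonzero constant factor. The type 1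 function is $$q_{n,m}^{\alpha}(x)=A_{n,m}^{\alpha}(x)\rho_\nu(x)+B_{n,m}^{\alpha}(x)\rho_{\nu+1}(x).$$ For $(n,m)=(0,-1)$ the convention is $B_{0,-1}^{\alpha}=0$, $A_{0,-1}^{\alpha}$ is a nonzero constant, and there are no orthogonality conditions, so $q_{0,-1}^{\alpha}$ is a nonzero constant multiple of $\rho_\nu$. *)

(* Defs.v *)
(* MathComp-Analysis development, over an arbitrary [R : realType]. *)
From HB Require Import structures.
From mathcomp Require Import all_boot all_order all_algebra.
From mathcomp Require Import all_classical all_reals all_analysis.

Set Implicit Arguments.
Unset Strict Implicit.
Unset Printing Implicit Defensive.

Import Order.TTheory GRing.Theory Num.Theory.
Import numFieldNormedType.Exports.

Local Open Scope classical_set_scope.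
Local Open Scope ring_scope.

(* The integral converges for every z > 0, the only case of interest. *)
Definition macdonaldK (R : realType) (nu z : R) : R :=
  2^-1 * (z / 2) `^ nu *
  Rintegral (@lebesgue_measure R) `]0, +oo[
    (fun t => expR (- t - z ^+ 2 / (4 * t)) * t `^ (- nu - 1)).

Definition rho (R : realType) (nu x : R) : R :=
  2 * x `^ (nu / 2) * macdonaldK nu (2 * Num.sqrt x).

Definition type1_fun (R : realType) (nu : R) (A B : {poly R}) (x : R) : R :=
  A.[x] * rho nu x + B.[x] * rho (nu + 1) x.

(* m is an integer so that m = n - 1 makes sense for n = 0: the size bound then
   forces B = 0, and the range of k is empty. *)
Definition is_type1 (R : realType) (nu alpha : R) (n : nat) (m : int)
    (A B : {poly R}) : Prop :=
  [/\ (A, B) <> (0, 0),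
      (size A <= n.+1)%N,
      (size B)%:Z <= m + 1 &
      forall k : nat, k%:Z <= n%:Z + m ->
        (\int[@lebesgue_measure R]_(x in `]0%R, +oo[%classic)
           (type1_fun nu A B x * x `^ (k%:R + alpha))%:E = 0)%E].

(* Main.v *)
Require Import Defs.
From HB Require Import structures.
From mathcomp Require Import all_boot all_order all_algebra.
From mathcomp Require Import all_classical all_reals all_analysis.
From mathcomp Require Import measurable_realfun zify ring lra.

(** The Mellin transform turns the type 1 functions into polynomials. With
    s > 0,
      int_0^oo x^(s-1) rho_nu(x) dx = Gamma(s) Gamma(s + nu),
    so that x^j rho_nu and x^j rho_(nu+1) have the transforms
    Gamma(s) Gamma(s + nu) times (s)_j (s + nu)_j and (s)_j (s + nu)_(j+1).
    These polynomials have degrees 2j and 2j + 1, hence form a basis, and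
    A rho_nu + B rho_(nu+1) is encoded without loss by a polynomial P, the
    [symbol] of (A, B) ([integral_type1_fun], [symbol_inj]).

    For the indices (n, m) with m = n or m = n - 1 the symbol has degree at
    most N = n + m + 1, and the N orthogonality conditions say that it vanishes
    at alpha + 1, ..., alpha + N. Therefore it is a nonzero multiple of
      prod_(k < N) (alpha + 1 + k - X),
    and the type 1 functions are normalized by making it equal to this product
    ([type1_symbol]).

    On the other side, x rho_nu' = nu rho_nu - rho_(nu+1) and
    rho_(nu+1)' = - rho_nu give
      (x^alpha (A rho_nu + B rho_(nu+1)))'
        = x^(alpha-1) (A1 rho_nu + B1 rho_(nu+1)),
    where A1 = (alpha + nu) A + x A' - x B and B1 = alpha B + x B' - A. The
    symbol of (A1, B1) is alpha - X times that of (A, B) ([symbol_deriv]), as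
    an integration by parts suggests. The factor alpha - X carries the product
    for (alpha, N) to the product for (alpha - 1, N + 1), which is the
    normalized symbol of the next index, and injectivity of the symbol turns
    the equality of symbols into the equality of functions.

    The analysis starts from
      rho_nu(x) = x^nu int_0^oo exp(- t - x / t) t^(- nu - 1) dt:
    the derivative of rho_nu comes from differentiation under the integral
    sign, that of rho_(nu+1) needs in addition one integration by parts in t,
    and the Mellin transform is Tonelli's theorem followed by the scaling
    x = t u. *)

Set Implicit Arguments.
Unset Strict Implicit.
Unset Printing Implicit Defensive.

Import Order.TTheory GRing.Theory Num.Theory.
Import numFieldNormedType.Exports.

Local Open Scope ring_scope.

(** * Symbols of pairs of polynomials *)

(** In Pochhammer notation (X)_j (X + nu)_j: by [gamma_fun_even] the ratio of
    the Mellin transforms of x^j rho_nu and of rho_nu. *)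
Definition mellin_even (R : comNzRingType) (nu : R) (j : nat) : {poly R} :=
  \prod_(i < j) (('X + i%:R%:P) * ('X + (nu + i%:R)%:P)).

(** (X)_j (X + nu)_(j+1): the same for x^j rho_(nu+1), see [gamma_fun_odd]. *)
Definition mellin_odd (R : comNzRingType) (nu : R) (j : nat) : {poly R} :=
  mellin_even nu j * ('X + (nu + j%:R)%:P).

(** The Mellin transform of A rho_nu + B rho_(nu+1) divided by that of rho_nu
    ([integral_type1_fun]). *)
Definition symbol (R : comNzRingType) (nu : R) (A B : {poly R}) : {poly R} :=
  \sum_(j < size A) A`_j *: mellin_even nu j +
  \sum_(j < size B) B`_j *: mellin_odd nu j.

Lemma sum_coef_widen (R : nzRingType) (V : lmodType R) (E : nat -> V)
    (p : {poly R}) (N : nat) : (size p <= N)%N ->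
  \sum_(j < size p) p`_j *: E j = \sum_(j < N) p`_j *: E j.
Proof.
move=> pN; rewrite (big_ord_widen N (fun j => p`_j *: E j) pN) big_mkcond /=.
apply: eq_bigr => i _; case: ltnP => // /(nth_default 0) ->.
by rewrite scale0r.
Qed.

(** A common bound for both sums, which makes the symbol visibly linear. *)
Lemma symbolE (R : comNzRingType) (nu : R) (A B : {poly R}) (N : nat) :
  (size A <= N)%N -> (size B <= N)%N ->
  symbol nu A B =
  \sum_(j < N) (A`_j *: mellin_even nu j + B`_j *: mellin_odd nu j).
Proof.
move=> AN BN; rewrite /symbol.
rewrite (sum_coef_widen (mellin_even nu) AN).
by rewrite (sum_coef_widen (mellin_odd nu) BN) big_split.
Qed.

Lemma mellin_evenS (R : comNzRingType) (nu : R) (j : nat) :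
  mellin_even nu j.+1 = mellin_odd nu j * ('X + j%:R%:P).
Proof.
rewrite /mellin_odd /mellin_even big_ord_recr /= -mulrA.
by rewrite [_ * ('X + j%:R%:P)]mulrC.
Qed.

Lemma symbol_lincomb (R : comNzRingType) (nu a b : R) (A B A' B' : {poly R}) :
  symbol nu (a *: A + b *: A') (a *: B + b *: B') =
  a *: symbol nu A B + b *: symbol nu A' B'.
Proof.
pose N := maxn (maxn (size A) (size A')) (maxn (size B) (size B')).
have sz (p q : {poly R}) : (size p <= N)%N -> (size q <= N)%N ->
    (size (a *: p + b *: q)%R <= N)%N.
  move=> pN qN; apply: leq_trans (size_polyD _ _) _; rewrite geq_max.
  by rewrite !(leq_trans (size_scale_leq _ _)).
have AN : (size A <= N)%N by rewrite /N !leq_max leqnn.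
have A'N : (size A' <= N)%N by rewrite /N !leq_max leqnn !orbT.
have BN : (size B <= N)%N by rewrite /N !leq_max leqnn !orbT.
have B'N : (size B' <= N)%N by rewrite /N !leq_max leqnn !orbT.
rewrite !(@symbolE _ _ _ _ N) ?sz// !scaler_sumr -big_split /=.
apply: eq_bigr => j _; rewrite !coefD !coefZ !scalerDl !scalerDr !scalerA.
by rewrite addrACA.
Qed.

(** The operator q |-> x^(1 - alpha) (x^alpha q)' on the coefficients of
    q = A rho_nu + B rho_(nu+1), see [is_derive_type1_fun]. *)
Definition deriv_fst (R : comNzRingType) (nu alpha : R) (A B : {poly R}) :=
  (alpha + nu) *: A + 'X * A^`() - 'X * B.
Definition deriv_snd (R : comNzRingType) (alpha : R) (A B : {poly R}) :=
  alpha *: B + 'X * B^`() - A.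

Lemma size_XMderiv (R : nzRingType) (p : {poly R}) :
  (size ('X * p^`())%R <= size p)%N.
Proof.
have [->|p0] := eqVneq p 0; first by rewrite derivC mulr0.
rewrite -commr_polyX; have [->|d0] := eqVneq p^`() 0.
  by rewrite mul0r size_poly0.
by rewrite size_mulX// lt_size_deriv.
Qed.

Lemma coefXMderiv (R : nzRingType) (p : {poly R}) (j : nat) :
  ('X * p^`())`_j = p`_j *+ j.
Proof. by case: j => [|j]; rewrite coefXM// ?mulr0n// coef_deriv. Qed.

(** Multiplication by X + nu + j leads from [mellin_even nu j] to
    [mellin_odd nu j], and X + j leads from there to [mellin_even nu j.+1]. So
    the image of x^j rho_nu has the symbol
    (alpha + nu + j) - (X + nu + j) = alpha - X times [mellin_even nu j], and
    that of x^j rho_(nu+1) has (alpha + j) - (X + j) = alpha - X times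
    [mellin_odd nu j]. *)
Lemma symbol_deriv (R : comNzRingType) (nu alpha : R) (A B : {poly R}) :
  symbol nu (deriv_fst nu alpha A B) (deriv_snd alpha A B) =
  (alpha%:P - 'X) * symbol nu A B.
Proof.
pose N := maxn (size A) (size B).
have AN : (size A <= N)%N by rewrite leq_max leqnn.
have BN : (size B <= N)%N by rewrite leq_max leqnn orbT.
have zero (p : {poly R}) : (size p <= N)%N -> p`_N = 0.
  exact: nth_default.
have sA : (size (deriv_fst nu alpha A B) <= N.+1)%N.
  rewrite (leq_trans (size_polyD _ _))// geq_max size_polyN.
  rewrite (leq_trans (size_polyD _ _)) ?geq_max /=.
    by rewrite (leq_trans (size_polyMleq _ _))// size_polyX.
  rewrite !(leq_trans (size_scale_leq _ _)) ?(leqW AN)//.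
  by rewrite (leq_trans (size_XMderiv _))// leqW.
have sB : (size (deriv_snd alpha A B) <= N.+1)%N.
  rewrite (leq_trans (size_polyD _ _))// geq_max size_polyN (leqW AN) andbT.
  rewrite (leq_trans (size_polyD _ _))// geq_max.
  rewrite !(leq_trans (size_scale_leq _ _)) ?(leqW BN)//.
  by rewrite (leq_trans (size_XMderiv _))// leqW.
rewrite (symbolE _ sA sB) (symbolE _ AN BN) mulr_sumr.
have shift : \sum_(j < N.+1) ('X * B)`_j *: mellin_even nu j =
    \sum_(j < N) B`_j *: mellin_even nu j.+1.
  rewrite big_ord_recl coefXM eqxx scale0r add0r.
  by apply: eq_bigr => j _; rewrite coefXM.
transitivity (\sum_(j < N.+1) (((alpha + nu) *: A + 'X * A^`())`_j *:
    mellin_even nu j + (deriv_snd alpha A B)`_j *: mellin_odd nu j) -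
    \sum_(j < N.+1) ('X * B)`_j *: mellin_even nu j).
  rewrite -sumrB; apply: eq_bigr => j _.
  by rewrite [in LHS]coefB scalerBl addrAC.
rewrite shift big_ord_recr /= !coefD !coefN !coefZ !coefXMderiv !zero//.
rewrite !(mulr0, mul0rn, oppr0, addr0, scale0r) -sumrB.
apply: eq_bigr => j _; rewrite mellin_evenS {1 3}/mellin_odd.
rewrite !coefD coefN !coefZ !coefXMderiv -!mul_polyC.
rewrite !(polyCD, polyCM, polyCN, polyCMn) -!polyC_natr /mellin_odd.
rewrite !(polyCD, polyCM, polyCN, polyCMn).
ring.
Qed.

Lemma mellin_even_monic (R : idomainType) (nu : R) (j : nat) :
  mellin_even nu j \is monic /\ size (mellin_even nu j) = j.*2.+1.
Proof.
elim: j => [|j [mj sj]].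
  by rewrite /mellin_even big_ord0 monic1 size_poly1.
rewrite mellin_evenS /mellin_odd.
have m1 : mellin_even nu j * ('X + (nu + j%:R)%:P) \is monic.
  by rewrite monicMl// monicXaddC.
split; first by rewrite monicMl// monicXaddC.
by rewrite !size_Mmonic ?monicXaddC ?monic_neq0// !size_XaddC sj !addn2.
Qed.

Lemma mellin_odd_monic (R : idomainType) (nu : R) (j : nat) :
  mellin_odd nu j \is monic /\ size (mellin_odd nu j) = j.*2.+2.
Proof.
have [mj sj] := mellin_even_monic nu j.
split; first by rewrite monicMl// monicXaddC.
by rewrite size_Mmonic ?monicXaddC ?monic_neq0// size_XaddC sj addn2.
Qed.

(** The monic polynomials [mellin_even nu j] and [mellin_odd nu j] have the
    pairwise distinct degrees 2j and 2j + 1, so the coefficients vanish one by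
    one from the top. *)
Lemma symbol_eq0 (R : idomainType) (nu : R) (A B : {poly R}) :
  symbol nu A B = 0 -> A = 0 /\ B = 0.
Proof.
pose N := maxn (size A) (size B).
have AN : (size A <= N)%N by rewrite leq_max leqnn.
have BN : (size B <= N)%N by rewrite leq_max leqnn orbT.
rewrite (symbolE _ AN BN).
suff key : forall M, \sum_(j < M) (A`_j *: mellin_even nu j +
    B`_j *: mellin_odd nu j) = 0 ->
    forall j, (j < M)%N -> A`_j = 0 /\ B`_j = 0.
  move=> /key zero; split; apply/polyP => j; rewrite coef0.
    have [/zero[]//|Nj] := ltnP j N.
    by rewrite nth_default// (leq_trans AN).
  have [/zero[]//|Nj] := ltnP j N.
  by rewrite nth_default// (leq_trans BN).
elim=> [//|M IH]; rewrite big_ord_recr /=.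
set S := \sum_(j < M) _ => S0.
have [/monicP meven seven] := mellin_even_monic nu M.
have [/monicP modd sodd] := mellin_odd_monic nu M.
have szS : (size S <= M.*2)%N.
  apply: (leq_trans (size_sum _ _ _)); apply/bigmax_leqP => i _.
  have [_ si] := mellin_even_monic nu i; have [_ ti] := mellin_odd_monic nu i.
  rewrite (leq_trans (size_polyD _ _))// geq_max.
  rewrite !(leq_trans (size_scale_leq _ _)) ?si ?ti//.
    by rewrite -doubleS leq_double.
  by rewrite ltn_double.
move: meven modd; rewrite !lead_coefE seven sodd /= => meven modd.
have BM : B`_M = 0.
  have /(congr1 (fun p : {poly R} => p`_(M.*2.+1))) := S0.
  rewrite !coefD !coefZ modd (nth_default _ (leqW szS)).
  rewrite [(mellin_even _ _)`_ _]nth_default ?seven//.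
  by rewrite mulr0 mulr1 !add0r coef0.
have AM : A`_M = 0.
  have /(congr1 (fun p : {poly R} => p`_(M.*2))) := S0.
  rewrite !coefD !coefZ BM meven (nth_default _ szS).
  by rewrite mul0r mulr1 add0r addr0 coef0.
move=> j; rewrite ltnS leq_eqVlt => /predU1P[->//|]; apply: IH.
by move: S0; rewrite AM BM !scale0r !addr0.
Qed.

Lemma symbol_inj (R : idomainType) (nu : R) (A B A' B' : {poly R}) :
  symbol nu A B = symbol nu A' B' -> A = A' /\ B = B'.
Proof.
move=> eq_symbol; have := symbol_lincomb nu 1 (-1) A B A' B'.
rewrite eq_symbol !scale1r !scaleN1r subrr.
by move=> /symbol_eq0[/eqP + /eqP]; rewrite !subr_eq0 => /eqP -> /eqP ->.
Qed.

(** The two cases of interest are M = n and M = n + 1; outside them one of the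
    degrees 2n and 2M - 1 exceeds n + M. *)
Lemma size_symbol (R : idomainType) (nu : R) (A B : {poly R}) (n M : nat) :
  (n <= M)%N -> (M <= n.+1)%N -> (size A <= n.+1)%N -> (size B <= M)%N ->
  (size (symbol nu A B) <= (n + M).+1)%N.
Proof.
move=> nM Mn An BM; rewrite /symbol (leq_trans (size_polyD _ _))// geq_max.
apply/andP; split; apply: (leq_trans (size_sum _ _ _));
  apply/bigmax_leqP => i _; rewrite (leq_trans (size_scale_leq _ _))//.
  have [_ ->] := mellin_even_monic nu i.
  rewrite ltnS -addnn leq_add//.
    by rewrite -ltnS (leq_trans (ltn_ord i)).
  by rewrite (leq_trans _ nM)// -ltnS (leq_trans (ltn_ord i)).
have [_ ->] := mellin_odd_monic nu i.
have iM : (i < M)%N := leq_trans (ltn_ord i) BM.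
by rewrite ltnS -addnn -addnS leq_add// -ltnS (leq_trans iM).
Qed.

(** The factors are not monic, so that lowering alpha by 1 multiplies the
    product by alpha - X and no sign appears ([root_prodS]). *)
Definition root_prod (R : nzRingType) (alpha : R) (N : nat) : {poly R} :=
  \prod_(k < N) ((alpha + 1 + k%:R)%:P - 'X).

Lemma root_prodS (R : nzRingType) (alpha : R) (N : nat) :
  root_prod (alpha - 1) N.+1 = (alpha%:P - 'X) * root_prod alpha N.
Proof.
rewrite /root_prod big_ord_recl /= subrK addr0; congr (_ * _).
apply: eq_bigr => i _; congr (_%:P - _).
by rewrite /bump /= natrD addrA.
Qed.

(** The constant that gives P the leading coefficient of a product
    [root_prod alpha N] of the same degree. The value at 0 keeps it nonzero at
    all indices, also for alpha <= -1, where nothing is known of P. *)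
Definition normalizer (R : fieldType) (P : {poly R}) : R :=
  if P == 0 then 1 else (-1) ^+ (size P).-1 / lead_coef P.

Lemma normalizer_neq0 (R : fieldType) (P : {poly R}) : normalizer P != 0.
Proof.
rewrite /normalizer; have [_|P0] := eqVneq P 0; first exact: oner_neq0.
by rewrite mulf_neq0 ?signr_eq0// invr_eq0 lead_coef_eq0.
Qed.

(** N distinct zeros and a degree at most N determine P up to its leading
    coefficient. *)
Lemma normalizerP (R : numFieldType) (alpha : R) (N : nat) (P : {poly R}) :
  P != 0 -> (size P <= N.+1)%N ->
  (forall k, (k < N)%N -> P.[alpha + 1 + k%:R] = 0) ->
  normalizer P *: P = root_prod alpha N.
Proof.
move=> P0 szP zeroP.
pose rs := [seq alpha + 1 + k%:R | k <- iota 0 N].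
have rs_uniq : uniq rs.
  rewrite map_inj_uniq ?iota_uniq// => i j /addrI/eqP.
  by rewrite eqr_nat => /eqP.
have rs_root : all (root P) rs.
  apply/allP => _ /mapP[k + ->]; rewrite mem_iota add0n => kN.
  by apply/rootP/zeroP.
have szrs : size rs = N by rewrite size_map size_iota.
have sizeP : size P = N.+1.
  by apply/eqP; rewrite eqn_leq szP -szrs max_poly_roots.
rewrite /normalizer (negbTE P0) sizeP /=.
rewrite [in LHS](@all_roots_prod_XsubC _ P rs) ?szrs ?uniq_rootsE//.
have lP0 : lead_coef P != 0 by rewrite lead_coef_eq0.
rewrite lead_coefZ scalerA (monicP (monic_prod_XsubC _ _ _)) mulr1 mulfVK//.
rewrite big_map -{2}[N]subn0 -/(index_iota 0 N) big_mkord /root_prod.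
under [RHS]eq_bigr do rewrite -opprB.
by rewrite prodrN cardT size_enum_ord -mul_polyC polyC_exp polyCN.
Qed.

(** * Integrals over the positive half-line *)

Section HalfLine.
Context {R : realType}.
Local Open Scope classical_set_scope.
Local Open Scope ring_scope.
Notation mu := (@lebesgue_measure R).
Notation halfline := (`]0%R, +oo[%classic : set R).
Local Notation seg c n := (`[(c / n.+1%:R)%R, (c * n.+1%:R)%R]%classic : set R).
Implicit Types (f g F : R -> R) (c x : R).

Lemma continuous_halfline_measurable f :
  (forall x, 0 < x -> {for x, continuous f}) -> measurable_fun halfline f.
Proof.
move=> cf; apply: open_continuous_measurable_fun; first exact: interval_open.
by move=> x; rewrite inE/= in_itv/= andbT => /cf.
Qed.

Lemma continuous_halfline_segment f a b : 0 < a ->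
  (forall x, 0 < x -> {for x, continuous f}) ->
  {within `[a, b]%classic, continuous f}.
Proof.
move=> a0 cf; apply: continuous_in_subspaceT => x; rewrite inE/= in_itv/=.
by move=> /andP[ax _]; apply/cf/(lt_le_trans a0).
Qed.

Lemma halfline_bigcup c : 0 < c ->
  halfline = \bigcup_n seg c n.
Proof.
move=> c0; apply/seteqP; split => x /=; rewrite in_itv/= andbT.
- move=> x0; pose n := Num.truncn (x / c + c / x).
  have nE : x / c + c / x <= n.+1%:R by rewrite ltW// truncnS_gt.
  have xc : 0 < x / c by rewrite divr_gt0.
  have cx : 0 < c / x by rewrite divr_gt0.
  exists n => //=; rewrite in_itv/=; apply/andP; split.
    rewrite ler_pdivrMr// mulrC -ler_pdivrMr//.
    by rewrite (le_trans _ nE)// lerDr ltW.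
  rewrite mulrC -ler_pdivrMr//.
  by rewrite (le_trans _ nE)// lerDl ltW.
- move=> [n _ /=]; rewrite in_itv/= => /andP[+ _]; apply: lt_le_trans.
  by rewrite divr_gt0.
Qed.

Lemma halfline_exhaust c f : 0 < c ->
  measurable_fun halfline f -> (forall x, 0 < x -> 0 <= f x) ->
  (\int[mu]_(x in seg c n) (f x)%:E @[n --> \oo] -->
   \int[mu]_(x in halfline) (f x)%:E)%E.
Proof.
move=> c0 mf f0; rewrite (halfline_bigcup c0).
apply: (@ge0_nondecreasing_set_cvg_integral _ (measurableTypeR R) R
  (fun n => seg c n) (EFin \o f) (@lebesgue_measure R)).
- move=> m n mn; rewrite subsetEset; apply: subset_itv; rewrite bnd_simp.
    by rewrite ler_pM2l// lef_pV2 ?posrE// ler_nat.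
  by rewrite ler_pM2l// ler_nat.
- by move=> i; exact: measurable_itv.
- move=> i; apply/measurable_EFinP; apply: measurable_funS mf => //.
  by rewrite (halfline_bigcup c0) => x xi; exists i.
- move=> i x; rewrite /= in_itv/= => /andP[cx _]; rewrite lee_fin f0//.
  by rewrite (lt_le_trans _ cx)// divr_gt0.
Qed.

(** On the compact interval from 1 / (n + 1) to n + 1 the fundamental theorem
    gives int f = int g + F(n + 1) - F(1 / (n + 1)), and both integrals
    increase to those over the half-line. Neither integral is assumed finite:
    finiteness of one is obtained from finiteness of the other in
    [kern0_integrable]. *)
Lemma halfline_FTC F f g :
  (forall x, 0 < x -> is_derive x 1 F (f x - g x)) ->
  (forall x, 0 < x -> {for x, continuous f}) ->
  (forall x, 0 < x -> {for x, continuous g}) ->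
  (forall x, 0 < x -> 0 <= f x) -> (forall x, 0 < x -> 0 <= g x) ->
  F x @[x --> 0^'+] --> 0 -> F x @[x --> +oo] --> 0 ->
  (\int[mu]_(x in halfline) (f x)%:E = \int[mu]_(x in halfline) (g x)%:E)%E.
Proof.
move=> dF cf cg f0 g0 F0 Foo.
have mf := continuous_halfline_measurable cf.
have mg := continuous_halfline_measurable cg.
have cF x : 0 < x -> {for x, continuous F}.
  move=> x0; apply/differentiable_continuous/derivable1_diffP.
  by have [] := dF x x0.
pose I n := seg 1 n.
have IE n : I n = `[n.+1%:R^-1, n.+1%:R]%classic by rewrite /I div1r mul1r.
have a0 n : 0 < n.+1%:R^-1 :> R by rewrite invr_gt0.
have iI h n : (forall x, 0 < x -> {for x, continuous h}) ->
    mu.-integrable (I n) (EFin \o h).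
  move=> ch; apply: continuous_compact_integrable; first exact: segment_compact.
  exact: continuous_halfline_segment.
have fE n : (\int[mu]_(x in I n) (f x)%:E =
    \int[mu]_(x in I n) (g x)%:E + (F (n.+1%:R) - F n.+1%:R^-1)%R%:E)%E.
  have FTC : (\int[mu]_(x in I n) (f x - g x)%:E =
      (F (n.+1%:R) - F n.+1%:R^-1)%R%:E)%E.
    have [n0|n0] := posnP n.
      by rewrite IE n0 /= invr1 set_itv1 integral_set1 subrr.
    have ltI : n.+1%:R^-1 < n.+1%:R :> R.
      have n1 : 1 < n.+1%:R :> R by rewrite ltr1n ltnS.
      by rewrite (lt_trans _ n1)// invf_lt1// (lt_trans _ n1).
    rewrite IE (@continuous_FTC2 _ (fun x => f x - g x) F)//.
    - apply: continuous_halfline_segment => // x x0.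
      by apply: cvgB; [exact: cf|exact: cg].
    - have /(continuous_within_itvP _ ltI)[_ ? ?] :=
        continuous_halfline_segment (b := n.+1%:R) (a0 n) cF.
      split => // x; rewrite in_itv/= => /andP[ax _].
      by have [] := dF x (lt_trans (a0 n) ax).
    - move=> x; rewrite in_itv/= => /andP[ax _].
      by rewrite derive1E; have [_ ->] := dF x (lt_trans (a0 n) ax).
  rewrite -FTC -integralD_EFin//=; last 3 first.
  - exact: measurable_itv.
  - exact: iI.
  - by apply: iI => x x0; apply: cvgB; [exact: cf|exact: cg].
  by apply: eq_integral => x _; rewrite -EFinD subrKC.
have := halfline_exhaust (@ltr01 R) mf f0.
rewrite -/I (funext fE).
suff : (\int[mu]_(x in I n) (g x)%:E + (F n.+1%:R - F n.+1%:R^-1)%R%:E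
    @[n --> \oo] --> \int[mu]_(x in halfline) (g x)%:E + 0%:E)%E.
  by move=> /cvg_unique uniq /uniq <-//; rewrite adde0.
apply: cvgeD; [by rewrite fin_num_adde_defl| |].
  exact: halfline_exhaust (@ltr01 R) mg g0.
apply: cvg_EFin; first exact: nearW.
rewrite -[X in _ --> X]subr0; apply: cvgB.
  have /cvg_pinftyP := Foo; apply.
  by rewrite (cvg_shiftS (fun n => n%:R : R)); exact: cvgr_idn.
have /cvg_at_rightP := F0; apply; split => // n.
exact: cvg_harmonic.
Qed.

(** Substitution on each compact interval of the exhaustion; f may be unbounded
    near 0, which excludes a substitution up to the endpoint. *)
Lemma halfline_scaling c f : 0 < c ->
  (forall x, 0 < x -> {for x, continuous f}) -> (forall x, 0 < x -> 0 <= f x) ->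
  (\int[mu]_(x in halfline) (c * f (c * x))%:E =
   \int[mu]_(x in halfline) (f x)%:E)%E.
Proof.
move=> c0 cf f0.
have mf := continuous_halfline_measurable cf.
have dM x : is_derive x 1 (fun y => c * y) c.
  by rewrite -[X in is_derive _ _ _ X]mulr1; exact: is_deriveZ.
have cM x : {for x, continuous (fun y => c * y)}.
  apply/differentiable_continuous/derivable1_diffP.
  by have [] := dM x.
have cfM x : 0 < x -> {for x, continuous (fun y => c * f (c * y))}.
  move=> x0; apply: cvgMl_tmp; apply: (@continuous_comp _ _ _ (fun y => c * y) f).
    exact: cM.
  by apply: cf; rewrite mulr_gt0.
have := halfline_exhaust c0 mf f0.
have := @halfline_exhaust 1 _ ltr01 (continuous_halfline_measurable cfM) _.
have pos x : 0 < x -> 0 <= c * f (c * x).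
  by move=> x0; rewrite mulr_ge0 ?(ltW c0)// f0// mulr_gt0.
move=> /(_ pos) lim1 lim2; apply: (cvg_unique _ lim1) => //.
rewrite (_ : (fun n => _) =
  (fun n => \int[mu]_(x in seg c n) (f x)%:E)%E)//; apply/funext => n.
rewrite div1r mul1r.
have dE : derive1 (fun y : R => c * y) = cst c.
  by apply/funext => x; rewrite derive1E; have [] := dM x.
have n0 : 0 < n.+1%:R^-1 :> R by rewrite invr_gt0.
have n1 : 1 <= n.+1%:R :> R by rewrite ler1n.
have nn : n.+1%:R^-1 <= n.+1%:R :> R by rewrite (le_trans _ n1)// invf_le1.
have := @integration_by_substitution_increasing _ (fun y => c * y) f _ _ nn.
rewrite dE => ->.
- by apply: eq_integral => x _; rewrite fctE mulrC.
- by move=> x y _ _ xy; rewrite ltr_pM2l.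
- by move=> x _; exact: cvg_cst.
- exact: is_cvg_cst.
- exact: is_cvg_cst.
- split; [by move=> x _; have [] := dM x| |].
    exact/cvg_at_right_filter/cM.
  exact/cvg_at_left_filter/cM.
- by apply: continuous_halfline_segment => //; rewrite mulr_gt0.
Qed.

End HalfLine.

(** * The kernel exp(- t - x / t) t^p *)

Section BesselKernel.
Context {R : realType}.
Local Open Scope classical_set_scope.
Local Open Scope ring_scope.
Notation mu := (@lebesgue_measure R).
Notation halfline := (`]0%R, +oo[%classic : set R).
Implicit Types (a c p x t : R).

(** The integrand of the Macdonald function; for x = 0 it is the integrand of
    Gamma(p + 1). *)
Definition kern p x t : R := expR (- t - x / t) * t `^ p.

Lemma kern_ge0 p x t : 0 <= kern p x t.
Proof. by rewrite mulr_ge0 ?expR_ge0 ?powR_ge0. Qed.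

Lemma kernS p x t : 0 < t -> kern (p + 1) x t = t * kern p x t.
Proof.
move=> t0; rewrite /kern powRD ?(lt0r_neq0 t0) ?implybT// powRr1 ?ltW//.
by rewrite [in RHS]mulrCA [t * _]mulrC.
Qed.

(** With u = c t / a this is u <= exp u, raised to the power a. *)
Lemma powR_le_expR a c t : 0 < a -> 0 < c -> 0 <= t ->
  t `^ a <= (a / c) `^ a * expR (c * t).
Proof.
move=> a0 c0 t0; have ac0 : 0 <= a / c by rewrite divr_ge0 ?ltW.
have an0 := lt0r_neq0 a0; have cn0 := lt0r_neq0 c0.
have {1}-> : t = (a / c) * (c * t / a) by field; rewrite an0 cn0.
have u0 : 0 <= c * t / a by rewrite divr_ge0 ?mulr_ge0 ?(ltW a0) ?(ltW c0).
rewrite powRM// ler_wpM2l ?powR_ge0//.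
rewrite [X in expR X](_ : _ = (c * t / a) * a); last by field.
rewrite expRM ge0_ler_powR ?nnegrE ?expR_ge0 ?(ltW a0)//.
by apply: le_trans (expR_ge1Dx _); rewrite lerDr.
Qed.

Lemma is_derive_kern_x p x t : 0 < t ->
  is_derive x 1 (fun y => kern p y t) (- kern (p - 1) x t).
Proof.
move=> t0.
have d1 : is_derive x (1 : R) (fun y : R => - t - y / t) (- t^-1).
  have := is_deriveB (is_derive_cst (- t) x (1 : R))
    (is_deriveM (is_derive_id x (1 : R)) (is_derive_cst (t^-1) x (1:R))).
  by move=> /is_derive_eq; apply; rewrite /GRing.scale /=; ring.
have d2 := is_derive1_comp (is_derive_expR _) d1.
have := is_deriveM d2 (is_derive_cst (t `^ p) x (1:R)).
move=> /is_derive_eq; apply; rewrite scaler0 add0r /kern.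
rewrite powRB ?(lt0r_neq0 t0) ?implybT// powRr1 ?ltW// /= /GRing.scale /=.
by field; rewrite gt_eqF.
Qed.

Lemma is_derive_kern_t p x t : 0 < t ->
  is_derive t 1 (kern p x)
    (x * kern (p - 2) x t + p * kern (p - 1) x t - kern p x t).
Proof.
move=> t0.
have d1 : is_derive t (1 : R) (fun y : R => - y - x / y) (- 1 + x / t ^+ 2).
  have dV := is_deriveV (lt0r_neq0 t0) (is_derive_id t (1 : R)).
  have := is_deriveB (is_deriveNid t (1:R))
    (is_deriveM (is_derive_cst x t (1 : R)) dV).
  move=> /is_derive_eq; apply; rewrite /GRing.scale /= mulr0 addr0 mulr1.
  by rewrite mulrN opprK.
have d2 := is_derive1_comp (is_derive_expR _) d1.
have := is_deriveM d2 (is_derive1_powR p t0).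
move=> /is_derive_eq; apply; rewrite /kern.
have -> : t `^ (p - 2) = t `^ p / t ^+ 2.
  by rewrite powRB ?(lt0r_neq0 t0) ?implybT// powR_mulrn ?ltW.
rewrite powRB ?(lt0r_neq0 t0) ?implybT// powRr1 ?ltW// /= /GRing.scale /=.
by field; rewrite gt_eqF.
Qed.

Lemma continuous_kern p x t : 0 < t -> {for t, continuous (kern p x)}.
Proof.
move=> t0; apply/differentiable_continuous/derivable1_diffP.
by have [] := is_derive_kern_t p x t0.
Qed.

Lemma measurable_kern p x : measurable_fun halfline (kern p x).
Proof. by apply: continuous_halfline_measurable => t; exact: continuous_kern. Qed.

(** Write t^p = t^a (1 / t)^b with a, b > 0. Half of the decay of exp(- t)
    absorbs t^a, and exp(- x0 / t) absorbs (1 / t)^b. The bound is uniform in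
    x >= x0, as needed for differentiation under the integral sign. *)
Lemma kern_bound p (x0 : R) : 0 < x0 -> exists C : R, 0 <= C /\
  forall x t, x0 <= x -> 0 < t -> kern p x t <= C * expR (- (t / 2)).
Proof.
move=> x00; pose a := `|p| + 1; pose b := a - p.
have a0 : 0 < a by rewrite ltr_wpDl.
have b0 : 0 < b.
  rewrite /b /a; have := ler_norm p; lra.
have h0 : 0 < 2^-1 :> R by rewrite invr_gt0.
(* These are the constants of [powR_le_expR] for the rates 1 / 2 and x0. *)
exists ((a / 2^-1) `^ a * (b / x0) `^ b); split.
  by rewrite mulr_ge0 ?powR_ge0.
move=> x t xx0 t0; rewrite /kern.
have -> : t `^ p = t `^ a * (t^-1) `^ b.
  rewrite -powR_inv1 ?ltW// -powRrM -powRD ?(lt0r_neq0 t0) ?implybT//.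
  by congr (_ `^ _); rewrite /b; ring.
have le1 := powR_le_expR a0 h0 (ltW t0).
have tV0 : 0 <= t^-1 by rewrite invr_ge0 ltW.
have le2 := powR_le_expR b0 x00 tV0.
have le3 : t `^ a * t^-1 `^ b <= ((a / 2^-1) `^ a * expR (2^-1 * t)) *
    ((b / x0) `^ b * expR (x0 * t^-1)).
  by rewrite ler_pM ?powR_ge0.
apply: (le_trans (ler_wpM2l (expR_ge0 _) le3)).
rewrite mulrACA [leLHS]mulrCA ler_wpM2l ?mulr_ge0 ?powR_ge0//.
rewrite -!expRD ler_expR.
have : x0 * t^-1 <= x / t by rewrite ler_wpM2r.
lra.
Qed.

Lemma kern0_bound p : 0 < p -> exists C : R, 0 <= C /\
  forall t, 0 < t -> kern p 0 t <= C * expR (- (t / 2)).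
Proof.
move=> p0; have h0 : 0 < 2^-1 :> R by rewrite invr_gt0.
exists ((p / 2^-1) `^ p); split; first exact: powR_ge0.
move=> t t0; rewrite /kern.
apply: (le_trans (ler_wpM2l (expR_ge0 _) (powR_le_expR p0 h0 (ltW t0)))).
rewrite mulrCA ler_wpM2l ?powR_ge0// -expRD ler_expR; lra.
Qed.

Lemma integrable_expR_half (C : R) :
  mu.-integrable halfline (EFin \o (fun t => C * expR (- (t / 2)))).
Proof.
have h0 : 0 < 2^-1 :> R by rewrite invr_gt0.
have : mu.-integrable halfline (EFin \o exponential_pdf (2^-1 : R)).
  by apply: integrableS (integrable_exponential_pdf h0).
move=> /(@integrableZl _ _ _ mu _ (measurable_itv _) (C * 2)).
apply: eq_integrable.
  exact: measurable_itv.
move=> t; rewrite inE/= in_itv/= andbT => t0.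
rewrite /= exponential_pdfE ?ltW// -EFinM; congr EFin.
rewrite mulrA -[C * 2 * _]mulrA mulfV ?mulr1 ?pnatr_eq0//.
by congr (_ * expR _); rewrite mulNr mulrC.
Qed.

Lemma cvg_expR_half (C : R) : C * expR (- (t / 2)) @[t --> +oo] --> 0.
Proof.
rewrite -[X in _ --> X](mulr0 C).
apply: cvgMl_tmp.
apply: (@cvg_comp _ _ _ (fun t => t / 2) (fun t => expR (- t)) _ (pinfty_nbhs R)).
  by apply: gt0_cvgMly => //; rewrite invr_gt0.
exact: cvgr_expR.
Qed.

Lemma kern_integrable p x : 0 < x -> mu.-integrable halfline (EFin \o kern p x).
Proof.
move=> x0; have [C [C0 le]] := kern_bound p x0.
apply: le_integrable (integrable_expR_half C) => //.
  by apply/measurable_EFinP; exact: measurable_kern.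
move=> t; rewrite /= in_itv/= andbT => t0.
rewrite lee_fin !ger0_norm ?kern_ge0 ?mulr_ge0 ?expR_ge0//.
exact: le.
Qed.

Lemma kern_cvgy p x : (0 < x) \/ (x = 0 /\ 0 < p) ->
  kern p x t @[t --> +oo] --> 0.
Proof.
move=> h; have [C le] : exists C,
    forall t, 0 < t -> kern p x t <= C * expR (- (t / 2)).
  case: h => [x0|[-> p0]].
    by have [C [_ le]] := kern_bound p x0; exists C => t; exact: le.
  by have [C [_ le]] := kern0_bound p0; exists C => t; exact: le.
apply: (@squeeze_cvgr _ _ _ _ (cst 0) (fun t => C * expR (- (t / 2)))).
- near=> t; rewrite kern_ge0/= le//; near: t; exact: nbhs_pinfty_gt.
- exact: cvg_cst.
- exact: cvg_expR_half.
Unshelve. all: by end_near. Qed.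

(** For x > 0 a factor t can be split off: t^p = t t^(p-1), and the kernel with
    exponent p - 1 is still bounded. *)
Lemma kern_cvg0 p x : (0 < x) \/ (x = 0 /\ 0 < p) ->
  kern p x t @[t --> 0^'+] --> 0.
Proof.
move=> [x0|[-> p0]].
  have [C [C0 le]] := kern_bound (p - 1) x0.
  apply: (@squeeze_cvgr _ _ _ _ (cst 0) (fun t => t * C)).
  - near=> t; have t0 : 0 < t by near: t; exact: nbhs_right_gt.
    rewrite kern_ge0/= -[X in kern X](subrK 1) kernS//.
    rewrite ler_wpM2l ?(ltW t0)// (le_trans (le _ _ _ t0))//.
    by rewrite ler_piMr// -expR0 ler_expR oppr_le0 divr_ge0 ?ltW.
  - exact: cvg_cst.
  - rewrite -[X in _ --> X](mul0r C); apply: cvgMr_tmp.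
    by apply: cvg_at_right_filter; exact: cvg_id.
apply: (@squeeze_cvgr _ _ _ _ (cst 0) (fun t => t `^ p)).
- near=> t; have t0 : 0 < t by near: t; exact: nbhs_right_gt.
  rewrite kern_ge0/= /kern ler_piMl ?powR_ge0// -expR0 ler_expR mul0r subr0.
  by rewrite oppr_le0 ltW.
- exact: cvg_cst.
- exact: powR_cvg0.
Unshelve. all: by end_near. Qed.

End BesselKernel.

(** * The gamma function *)

Section Gamma.
Context {R : realType}.
Local Open Scope classical_set_scope.
Local Open Scope ring_scope.
Notation mu := (@lebesgue_measure R).
Notation halfline := (`]0%R, +oo[%classic : set R).
Implicit Types (a c p x t : R).

Definition gamma_fun a : R := \int[mu]_(t in halfline) kern (a - 1) 0 t.

(** Integration by parts for a Gamma(a) = Gamma(a + 1), as an equality of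
    possibly infinite integrals. *)
Lemma integral_kern0_rec a : 0 < a ->
  (a%:E * \int[mu]_(t in halfline) (kern (a - 1) 0 t)%:E =
   \int[mu]_(t in halfline) (kern a 0 t)%:E)%E.
Proof.
move=> a0.
rewrite -ge0_integralZl_EFin ?(ltW a0)//=; last 2 first.
- by move=> t _; rewrite lee_fin kern_ge0.
- by apply/measurable_EFinP; exact: measurable_kern.
under eq_integral do rewrite -EFinM.
apply: (@halfline_FTC _ (kern a 0)).
- move=> t t0; have := is_derive_kern_t a 0 t0.
  by rewrite mul0r add0r.
- by move=> t t0; apply: cvgMl_tmp; exact: continuous_kern.
- by move=> t t0; exact: continuous_kern.
- by move=> t t0; rewrite mulr_ge0 ?kern_ge0// ltW.
- by move=> t t0; exact: kern_ge0.
- by apply: kern_cvg0; right.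
- by apply: kern_cvgy; right.
Qed.

(** The kernel with exponent p + 1 > 0 is bounded by an exponential, and the
    recurrence transfers its integrability to the exponent p, where the
    integrand may be singular at 0. *)
Lemma kern0_integrable p : -1 < p -> mu.-integrable halfline (EFin \o kern p 0).
Proof.
move=> p1; have p0 : 0 < p + 1 by lra.
have mk (q : R) : measurable_fun halfline (EFin \o kern q 0).
  by apply/measurable_EFinP; exact: measurable_kern.
have ipS : mu.-integrable halfline (EFin \o kern (p + 1) 0).
  have [C [C0 le]] := kern0_bound p0.
  apply: le_integrable (integrable_expR_half C) => //.
    exact: mk.
  move=> t; rewrite /= in_itv/= andbT => t0.
  rewrite lee_fin !ger0_norm ?kern_ge0 ?mulr_ge0 ?expR_ge0//.
  exact: le.
apply/integrableP; split; first exact: mk.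
under eq_integral do rewrite /= ger0_norm ?kern_ge0//.
have := integral_kern0_rec p0; rewrite addrK.
have /integrable_lty := ipS => /(_ (measurable_itv _)) /= lty eq_rec.
rewrite ltey; apply/negP => /eqP Ioo; move: lty.
by rewrite -eq_rec Ioo gt0_muley ?lte_fin.
Qed.

Lemma integral_kern0 a : 0 < a ->
  (\int[mu]_(t in halfline) (kern (a - 1) 0 t)%:E = (gamma_fun a)%:E)%E.
Proof.
move=> a0; rewrite /gamma_fun /Rintegral fineK//.
apply: integrable_fin_num => //; apply: kern0_integrable; lra.
Qed.

Lemma gamma_funS a : 0 < a -> gamma_fun (a + 1) = a * gamma_fun a.
Proof.
move=> a0; have := integral_kern0_rec a0.
rewrite integral_kern0// -[X in kern X 0](addrK 1 a).
rewrite integral_kern0; last by lra.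
by rewrite -EFinM => -[].
Qed.

(** For b >= 1 the integrand is at least exp(- 2) on the interval from 1 to 2;
    the recurrence gives the other values. *)
Lemma gamma_fun_gt0 a : 0 < a -> 0 < gamma_fun a.
Proof.
suff gt0 b : 1 <= b -> 0 < gamma_fun b.
  move=> a0; have := gt0 (a + 1); rewrite gamma_funS//.
  by rewrite pmulr_rgt0//; apply; lra.
move=> b1; rewrite -lte_fin -integral_kern0; last by lra.
have mk : measurable_fun halfline (EFin \o kern (b - 1) 0).
  by apply/measurable_EFinP; exact: measurable_kern.
have sub : `[1, 2] `<=` halfline.
  by move=> t /=; rewrite !in_itv/= andbT => /andP[+ _]; apply: lt_le_trans.
apply: (@lt_le_trans _ _ (\int[mu]_(t in `[1%R, 2%R]) (expR (- 2))%:E)%E).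
  rewrite integral_cst//= lebesgue_measure_itv/= lte_fin ltr1n/=.
  by rewrite -EFinD -EFinM lte_fin mulr_gt0 ?expR_gt0//; lra.
apply: (@le_trans _ _ (\int[mu]_(t in `[1%R, 2%R]) (kern (b - 1) 0 t)%:E)%E).
  apply: ge0_le_integral => //.
  - by apply/measurable_EFinP; apply: measurable_funS (measurable_kern _ _).
  - move=> t /=; rewrite in_itv/= => /andP[t1 t2].
    rewrite lee_fin /kern mul0r subr0 -[leLHS]mulr1 ler_pM ?expR_ge0//.
      by rewrite ler_expR lerN2.
    rewrite -[leLHS](powRr0 t) ler_powR//; lra.
apply: ge0_subset_integral => //.
by move=> t _; rewrite lee_fin kern_ge0.
Qed.

End Gamma.

(** * Derivatives of rho *)

Section Rho.
Context {R : realType}.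
Local Open Scope classical_set_scope.
Local Open Scope ring_scope.
Notation mu := (@lebesgue_measure R).
Notation halfline := (`]0%R, +oo[%classic : set R).
Implicit Types (nu p s x t : R).

Definition kern_integral p x : R := \int[mu]_(t in halfline) kern p x t.

(** Differentiation under the integral sign; near x the derivative of the
    integrand is dominated by the bound for the points above x / 2. *)
Lemma is_derive_kern_integral p x : 0 < x ->
  is_derive x 1 (kern_integral p) (- kern_integral (p - 1) x).
Proof.
move=> x0; have x20 : 0 < x / 2 by rewrite divr_gt0.
have [C [C0 le]] := kern_bound (p - 1) x20.
pose G t := C * expR (- (t / 2)).
have Ix : `]x / 2, 2 * x[%classic x.
  by rewrite /= in_itv/=; apply/andP; split; lra.
have intf y : `]x / 2, 2 * x[%classic y ->
    mu.-integrable halfline (EFin \o kern p y).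
  rewrite /= in_itv/= => /andP[xy _].
  by apply: kern_integrable; rewrite (lt_trans x20).
have derf y t : `]x / 2, 2 * x[%classic y -> halfline t ->
    derivable (fun y => kern p y t) y 1.
  move=> _; rewrite /= in_itv/= andbT => t0.
  by have [] := is_derive_kern_x p y t0.
have d1E y t : halfline t -> partial1of2 (kern p) y t = - kern (p - 1) y t.
  rewrite /= in_itv/= andbT => t0; rewrite partial1of2E.
  by have [_ ->] := is_derive_kern_x p y t0.
have G0 t : 0 <= G t by rewrite mulr_ge0 ?expR_ge0.
have intG : mu.-integrable halfline (EFin \o G) by exact: integrable_expR_half.
have Gub y t : `]x / 2, 2 * x[%classic y -> halfline t ->
    `|partial1of2 (kern p) y t| <= G t.
  move=> + t0; rewrite d1E// normrN ger0_norm ?kern_ge0//.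
  rewrite /= in_itv/= => /andP[/ltW xy _]; apply: le => //.
  by move: t0; rewrite /= in_itv/= andbT.
apply: DeriveDef.
  exact: (@derivable_under_integral _ _ _ mu _ _ _ _ _ _ Ix intf derf
    _ G0 intG Gub).
rewrite -derive1E.
rewrite (@differentiation_under_integral _ _ _ mu _ _ _ _ _ _ Ix intf derf
  _ G0 intG Gub)//.
rewrite /kern_integral -[RHS]mulN1r -RintegralZl//; last exact: kern_integrable.
by apply: eq_Rintegral => t /set_mem t0; rewrite d1E// mulN1r.
Qed.

(** The integral over t of the derivative of the kernel is 0. The sign of p
    makes the terms on either side of the equality nonnegative. *)
Lemma kern_integral_rec p x : 0 < x -> p <= 0 ->
  x * kern_integral (p - 2) x = kern_integral p x - p * kern_integral (p - 1) x.
Proof.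
move=> x0 p0; have ki q := kern_integrable q x0.
have : (\int[mu]_(t in halfline) (x * kern (p - 2) x t)%:E =
    \int[mu]_(t in halfline) (kern p x t + - p * kern (p - 1) x t)%:E)%E.
  apply: (@halfline_FTC _ (kern p x)).
  - by move=> t t0; have /is_derive_eq := is_derive_kern_t p x t0; apply; ring.
  - by move=> t t0; apply: cvgMl_tmp; exact: continuous_kern.
  - move=> t t0; apply: cvgD; first exact: continuous_kern.
    by apply: cvgMl_tmp; exact: continuous_kern.
  - by move=> t t0; rewrite mulr_ge0 ?kern_ge0// ltW.
  - move=> t t0; apply: addr_ge0; first exact: kern_ge0.
    by apply: mulr_ge0; rewrite ?kern_ge0 ?oppr_ge0.
  - by apply: kern_cvg0; left.
  - by apply: kern_cvgy; left.
move=> /(congr1 fine); rewrite -!/(Rintegral _ _ _) RintegralZl// => ->.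
rewrite RintegralD//; first by rewrite RintegralZl// mulNr.
move: (ki (p - 1)) => /(@integrableZl _ _ _ mu _ (measurable_itv _) (- p)).
by apply: eq_integrable => //; exact: measurable_itv.
Qed.

(** The substitution z = 2 sqrt x makes z^2 / (4 t) = x / t. *)
Lemma rhoE nu x : 0 < x -> rho nu x = x `^ nu * kern_integral (- nu - 1) x.
Proof.
move=> x0; rewrite /rho /macdonaldK -[2 * Num.sqrt x / 2]mulrAC mulfV// mul1r.
rewrite -powR12_sqrt ?ltW// -powRrM.
have -> : \int[mu]_(t in halfline)
    (expR (- t - (2 * x `^ 2^-1) ^+ 2 / (4 * t)) * t `^ (- nu - 1)) =
    kern_integral (- nu - 1) x.
  apply: eq_Rintegral => t; rewrite inE/= in_itv/= andbT => t0.
  rewrite /kern; congr (expR (_ - _) * _).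
  rewrite exprMn powR12_sqrt ?ltW// sqr_sqrtr ?ltW//.
  by field; rewrite gt_eqF.
rewrite [2^-1 * nu]mulrC.
have -> : x `^ nu = x `^ (nu / 2) * x `^ (nu / 2).
  by rewrite -powRD ?(lt0r_neq0 x0) ?implybT// -splitr.
by field.
Qed.

Lemma is_derive_rho nu x : 0 < x ->
  is_derive x 1 (rho nu) ((nu * rho nu x - rho (nu + 1) x) / x).
Proof.
move=> x0.
have := is_deriveM (is_derive1_powR nu x0)
  (is_derive_kern_integral (- nu - 1) x0).
set f := (f in is_derive _ _ f _) => d.
apply: (@near_eq_is_derive _ _ _ f).
  near=> y; rewrite rhoE//; near: y; exact: lt_nbhsr.
apply: is_derive_eq d _; rewrite !rhoE// opprD.
have -> : x `^ (nu - 1) = x `^ nu / x.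
  by rewrite powRB ?(lt0r_neq0 x0) ?implybT// powRr1 ?ltW.
have -> : x `^ (nu + 1) = x `^ nu * x.
  by rewrite powRD ?(lt0r_neq0 x0) ?implybT// powRr1 ?ltW.
rewrite /GRing.scale /=.
by field; rewrite gt_eqF.
Unshelve. all: by end_near. Qed.

(** The general formula expresses the derivative of rho_(nu+1) by rho_(nu+1)
    and rho_(nu+2); the three-term recurrence of the kernel integrals reduces
    this to rho_nu. *)
Lemma is_derive_rhoS nu x : 0 <= nu -> 0 < x ->
  is_derive x 1 (rho (nu + 1)) (- rho nu x).
Proof.
move=> nu0 x0; apply: is_derive_eq (is_derive_rho (nu + 1) x0) _.
have p0 : - nu - 1 <= 0 by lra.
have := kern_integral_rec x0 p0; rewrite !rhoE//.
have -> : - nu - 1 - 2 = - (nu + 1 + 1) - 1 by ring.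
have -> : - nu - 1 - 1 = - (nu + 1) - 1 by ring.
rewrite !powRD ?(lt0r_neq0 x0) ?implybT// powRr1 ?ltW//.
move=> rec.
have -> : kern_integral (- nu - 1) x = x * kern_integral (- (nu + 1 + 1) - 1) x
   - (nu + 1) * kern_integral (- (nu + 1) - 1) x.
  rewrite rec; ring.
by field; rewrite gt_eqF.
Qed.

End Rho.

(** * The Mellin transform of rho *)

Section Mellin.
Context {R : realType}.
Local Open Scope classical_set_scope.
Local Open Scope ring_scope.
Notation mu := (@lebesgue_measure R).
Notation halfline := (`]0%R, +oo[%classic : set R).
Implicit Types (nu p s x t : R).

Lemma integral_halflineE (f : R -> R) :
  (\int[mu]_(x in halfline) (f x)%:E = \int[mu]_x (\1_halfline x * f x)%:E)%E.
Proof.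
rewrite integral_mkcond; apply: eq_integral => x _.
rewrite patchE indicE; case: (x \in _); first by rewrite mul1r.
by rewrite mul0r.
Qed.

(** The inner integral after the exchange in [integral_rho_mellin], by the
    scaling x = t u. *)
Lemma integral_kern_scale b t : 0 < b -> 0 < t ->
  (\int[mu]_(x in halfline) (x `^ (b - 1) * expR (- (x / t)))%:E =
   (t `^ b * gamma_fun b)%:E)%E.
Proof.
move=> b0 t0; have tn0 := lt0r_neq0 t0.
have tV0 : 0 < t^-1 by rewrite invr_gt0.
have cont x : 0 < x -> {for x, continuous (kern (b - 1) 0)}.
  exact: continuous_kern.
have pos x : 0 < x -> 0 <= kern (b - 1) 0 x by move=> _; exact: kern_ge0.
rewrite EFinM -integral_kern0// -(halfline_scaling tV0 cont pos).
rewrite -ge0_integralZl_EFin ?powR_ge0//=; last 2 first.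
- move=> x; rewrite in_itv/= => _.
  by rewrite lee_fin mulr_ge0 ?kern_ge0// ltW.
- apply/measurable_EFinP; apply: continuous_halfline_measurable => x x0.
  apply: cvgMl_tmp; apply: (@continuous_comp _ _ _ (fun y => t^-1 * y)).
    by apply: cvgMl_tmp; exact: cvg_id.
  by apply: cont; rewrite mulr_gt0.
apply: eq_integral => x; rewrite inE/= in_itv/= andbT => x0.
rewrite -EFinM; congr EFin; rewrite /kern mul0r subr0.
rewrite powRM ?ltW// -[t^-1]powR_inv1 ?ltW// -powRrM.
have -> : t `^ (-1 * (b - 1)) = t `^ (1 - b) by congr (_ `^ _); ring.
rewrite [RHS](_ : _ = (t `^ b * t `^ (-1) * t `^ (1 - b)) *
  (x `^ (b - 1) * expR (- (t `^ (-1) * x)))); last by ring.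
rewrite -!powRD ?tn0 ?implybT// (_ : b + -1 + (1 - b) = 0) ?powRr0; last by ring.
by rewrite mul1r powR_inv1 ?ltW// [t^-1 * x]mulrC.
Qed.

(** Tonelli's theorem for x^(s + nu - 1) exp(- t - x / t) t^(- nu - 1):
    integrating first in x gives t^(s + nu) Gamma(s + nu), and what remains is
    the integrand of Gamma(s). *)
Lemma integral_rho_mellin nu s : 0 <= nu -> 0 < s ->
  (\int[mu]_(x in halfline) (x `^ (s - 1) * rho nu x)%:E =
   (gamma_fun s * gamma_fun (s + nu))%:E)%E.
Proof.
move=> nu0 s0; have snu0 : 0 < s + nu by rewrite ltr_pwDl.
(* The power z.2 `^ (-1) replaces the inverse: powers are measurable on the
   whole line. *)
pose J (z : R * R) : \bar R := (\1_halfline z.1 * (\1_halfline z.2 *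
  (z.1 `^ (s + nu - 1) *
   (expR (- z.2 - z.1 * z.2 `^ (-1)) * z.2 `^ (- nu - 1)))))%:E.
have mJ : measurable_fun setT J.
  apply/measurable_EFinP.
  have mH : measurable_fun setT (\1_halfline : R -> R).
    by apply: measurable_indic; exact: measurable_itv.
  have mP q : measurable_fun setT (fun y : R => y `^ q) by exact: measurable_powR.
  apply: measurable_funM; first exact: (measurableT_comp mH measurable_fst).
  apply: measurable_funM; first exact: (measurableT_comp mH measurable_snd).
  apply: measurable_funM.
    exact: (measurableT_comp (mP _) measurable_fst).
  apply: measurable_funM; last first.
    exact: (measurableT_comp (mP _) measurable_snd).
  apply: measurableT_comp; first exact: measurable_expR.
  apply: measurable_funB; first exact: (measurableT_comp _ measurable_snd).
  apply: measurable_funM; first exact: measurable_fst.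
  exact: (measurableT_comp (mP _) measurable_snd).
have J0 z : (0 <= J z)%E.
  rewrite lee_fin !indicE; do 2! (apply: mulr_ge0; first exact: ler0n).
  by rewrite !mulr_ge0 ?powR_ge0 ?expR_ge0.
have := fubini_tonelli (m1 := mu) (m2 := mu) J mJ J0.
have -> : (\int[mu]_x \int[mu]_y J (x, y) =
    \int[mu]_(x in halfline) (x `^ (s - 1) * rho nu x)%:E)%E.
  rewrite [RHS]integral_mkcond; apply: eq_integral => x _.
  rewrite patchE; case: ifPn => [|xH]; last first.
    apply: integral0_eq => y _; rewrite /J /= indicE (negbTE xH).
    by rewrite mul0r.
  rewrite inE/= in_itv/= andbT => x0.
  rewrite /J /= indicE mem_set/=; last by rewrite in_itv/= andbT.
  under eq_integral do rewrite mul1r.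
  rewrite -(integral_halflineE (fun y => x `^ (s + nu - 1) *
    (expR (- y - x * y `^ (-1)) * y `^ (- nu - 1)))).
  transitivity (\int[mu]_(y in halfline) (x `^ (s + nu - 1) *
      kern (- nu - 1) x y)%:E)%E.
    apply: eq_integral => y; rewrite inE/= in_itv/= andbT => y0.
    by rewrite /kern powR_inv1 ?ltW.
  rewrite rhoE//; under eq_integral do rewrite EFinM.
  rewrite integralZl//; last exact: kern_integrable.
  rewrite mulrA -powRD ?(lt0r_neq0 x0) ?implybT//.
  have -> : s - 1 + nu = s + nu - 1 by ring.
  rewrite EFinM /kern_integral /Rintegral fineK//.
  by apply: integrable_fin_num => //; exact: kern_integrable.
move=> ->.
transitivity (\int[mu]_(t in halfline)
    (gamma_fun (s + nu) * kern (s - 1) 0 t)%:E)%E.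
  rewrite [RHS]integral_mkcond; apply: eq_integral => t _.
  rewrite patchE; case: ifPn => [|tH]; last first.
    apply: integral0_eq => x _; rewrite /J /= !indicE (negbTE tH).
    by rewrite mul0r mulr0.
  rewrite inE/= in_itv/= andbT => t0.
  rewrite /J /= [\1_halfline t]indicE mem_set/=; last by rewrite in_itv/= andbT.
  under eq_integral do rewrite mul1r.
  rewrite -(integral_halflineE (fun x => x `^ (s + nu - 1) *
    (expR (- t - x * t `^ (-1)) * t `^ (- nu - 1)))).
  transitivity (\int[mu]_(x in halfline) ((expR (- t) * t `^ (- nu - 1)) *
      (x `^ (s + nu - 1) * expR (- (x / t))))%:E)%E.
    apply: eq_integral => x; rewrite inE/= in_itv/= andbT => x0.
    by rewrite powR_inv1 ?ltW// expRD; congr EFin; ring.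
  under eq_integral do rewrite EFinM.
  rewrite ge0_integralZl_EFin//=; last 3 first.
  - by move=> x _; rewrite lee_fin mulr_ge0 ?powR_ge0 ?expR_ge0.
  - apply/measurable_EFinP; apply: measurable_funM.
      by apply: measurable_funTS; exact: measurable_powR.
    apply: measurable_funTS; apply: measurableT_comp => //.
    by apply: measurableT_comp => //; exact: measurable_funM.
  - by rewrite mulr_ge0 ?expR_ge0 ?powR_ge0.
  rewrite integral_kern_scale// -EFinM; congr EFin.
  rewrite /kern mul0r subr0.
  have -> : s - 1 = (- nu - 1) + (s + nu) by ring.
  by rewrite (@powRD _ t (- nu - 1) (s + nu)) ?(lt0r_neq0 t0) ?implybT//; ring.
under eq_integral do rewrite EFinM.
rewrite integralZl//; last by apply: kern0_integrable; lra.
by rewrite integral_kern0// -EFinM mulrC.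
Qed.

End Mellin.

(** * Type 1 functions *)

Section Type1.
Context {R : realType}.
Local Open Scope classical_set_scope.
Local Open Scope ring_scope.
Notation mu := (@lebesgue_measure R).
Notation halfline := (`]0%R, +oo[%classic : set R).
Implicit Types (nu p s x t alpha : R) (A B : {poly R}).

Lemma rho_integrable nu s : 0 <= nu -> 0 < s ->
  mu.-integrable halfline (EFin \o (fun x => x `^ (s - 1) * rho nu x)).
Proof.
move=> nu0 s0; apply/integrableP; split.
  apply/measurable_EFinP; apply: continuous_halfline_measurable => x x0.
  have := is_deriveM (is_derive1_powR (s - 1) x0) (is_derive_rho nu x0).
  by case=> /derivable1_diffP/differentiable_continuous.
under eq_integral => x xH.
  have x0 : 0 < x by move: xH; rewrite inE/= in_itv/= andbT.
  have rho0 : 0 <= rho nu x.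
    rewrite rhoE// mulr_ge0 ?powR_ge0//.
    by apply: Rintegral_ge0 => t _; exact: kern_ge0.
  have q0 : 0 <= x `^ (s - 1) * rho nu x by exact: mulr_ge0 (powR_ge0 _ _) rho0.
  rewrite /= ger0_norm//.
  over.
have := ltry (gamma_fun s * gamma_fun (s + nu)).
by rewrite -integral_rho_mellin.
Qed.

Lemma integral_poly_rho nu s (q : {poly R}) : 0 <= nu -> 0 < s ->
  mu.-integrable halfline (EFin \o (fun x => q.[x] * rho nu x * x `^ (s - 1))) /\
  (\int[mu]_(x in halfline) (q.[x] * rho nu x * x `^ (s - 1))%:E =
   (\sum_(j < size q) q`_j *
     (gamma_fun (s + j%:R) * gamma_fun (s + j%:R + nu)))%:E)%E.
Proof.
move=> nu0 s0.
have sj (j : nat) : 0 < s + j%:R by rewrite ltr_pwDl.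
pose h (j : nat) x := (x `^ (s + j%:R - 1) * rho nu x)%:E.
have ih j : mu.-integrable halfline (h j) by exact: rho_integrable.
have iZh j : mu.-integrable halfline (fun x => (q`_j)%:E * h j x)%E.
  by apply: integrableZl => //; exact: measurable_itv.
have expand x : x \in halfline -> (q.[x] * rho nu x * x `^ (s - 1))%:E =
    (\sum_(j < size q) (q`_j)%:E * h j x)%E.
  rewrite inE/= in_itv/= andbT => x0.
  rewrite horner_coef -mulrA mulr_suml sumEFin; congr EFin; apply: eq_bigr => j _.
  have -> : s + j%:R - 1 = j%:R + (s - 1) by ring.
  rewrite (@powRD _ x j%:R (s - 1)) ?(lt0r_neq0 x0) ?implybT//.
  by rewrite powR_mulrn ?ltW//; ring.
split.
  apply: (@eq_integrable _ _ _ mu _ _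
      (fun x => \sum_(j < size q) (q`_j)%:E * h j x)%E) => //.
  - by move=> x xH; rewrite -expand.
  - by apply: integrable_sum => //.
transitivity (\int[mu]_(x in halfline) \sum_(j < size q) (q`_j)%:E * h j x)%E.
  by apply: eq_integral.
rewrite integral_sum//.
rewrite -sumEFin; apply: eq_bigr => j _.
by rewrite integralZl// integral_rho_mellin// -EFinM.
Qed.

(** The recurrence of Gamma, used j times in each factor. *)
Lemma gamma_fun_even nu s (j : nat) : 0 <= nu -> 0 < s ->
  gamma_fun (s + j%:R) * gamma_fun (s + j%:R + nu) =
  gamma_fun s * gamma_fun (s + nu) * (mellin_even nu j).[s].
Proof.
move=> nu0 s0; elim: j => [|j IH].
  by rewrite /mellin_even big_ord0 hornerC addr0 mulr1.
have sj : 0 < s + j%:R by rewrite ltr_pwDl.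
have -> : s + j.+1%:R + nu = s + j%:R + nu + 1 by rewrite -natr1; ring.
have -> : s + j.+1%:R = s + j%:R + 1 by rewrite -natr1; ring.
rewrite !gamma_funS ?ltr_pwDl// mulrACA IH mellin_evenS /mellin_odd.
by rewrite !(hornerM, hornerD, hornerX, hornerC); ring.
Qed.

Lemma gamma_fun_odd nu s (j : nat) : 0 <= nu -> 0 < s ->
  gamma_fun (s + j%:R) * gamma_fun (s + j%:R + (nu + 1)) =
  gamma_fun s * gamma_fun (s + nu) * (mellin_odd nu j).[s].
Proof.
move=> nu0 s0; have sj : 0 < s + j%:R by rewrite ltr_pwDl.
rewrite addrA gamma_funS ?ltr_pwDl// mulrCA gamma_fun_even// /mellin_odd.
by rewrite !(hornerM, hornerD, hornerX, hornerC); ring.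
Qed.

Lemma integral_type1_fun nu s A B : 0 <= nu -> 0 < s ->
  (\int[mu]_(x in halfline) (type1_fun nu A B x * x `^ (s - 1))%:E =
   (gamma_fun s * gamma_fun (s + nu) * (symbol nu A B).[s])%:E)%E.
Proof.
move=> nu0 s0; have nu10 : 0 <= nu + 1 by rewrite addr_ge0.
have [iA IA] := integral_poly_rho A nu0 s0.
have [iB IB] := integral_poly_rho B nu10 s0.
under eq_integral do rewrite /type1_fun mulrDl EFinD.
rewrite integralD//= IA IB -EFinD; congr EFin.
rewrite /symbol hornerD !horner_sum mulrDr !mulr_sumr.
congr (_ + _); apply: eq_bigr => j _; rewrite hornerZ.
  by rewrite gamma_fun_even// mulrCA.
by rewrite gamma_fun_odd// mulrCA.
Qed.

(** The moments are Gamma(s) Gamma(s + nu) P(s) at s = alpha + 1 + k, and Gamma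
    does not vanish. So the N conditions are N zeros of the symbol P, whose
    degree is at most N. *)
Lemma type1_symbol nu alpha (n : nat) (m : int) (N : nat) A B :
  0 <= nu -> -1 < alpha -> m = n%:Z \/ m = n%:Z - 1 ->
  N%:Z = n%:Z + m + 1 -> is_type1 nu alpha n m A B ->
  normalizer (symbol nu A B) *: symbol nu A B = root_prod alpha N.
Proof.
move=> nu0 alpha1 mn NE [AB0 sizeA sizeB orth].
apply: normalizerP.
- apply/eqP => /symbol_eq0[A0 B0]; apply: AB0; by rewrite A0 B0.
- have [M ME] : exists M : nat, M%:Z = m + 1.
    by case: mn => ->; [exists n.+1; lia|exists n; lia].
  have NM : N = (n + M)%N.
    by apply/eqP; rewrite -eqz_nat NE PoszD ME addrA.
  rewrite NM; apply: size_symbol => //.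
  + by rewrite -lez_nat ME; case: mn => -> //; lia.
  + by rewrite -lez_nat ME; case: mn => ->; lia.
  + by rewrite -lez_nat ME.
- move=> k kN; have s0 : 0 < alpha + 1 + k%:R.
    by rewrite ltr_pwDl// -ltrBlDr sub0r.
  have kle : k%:Z <= n%:Z + m by move: kN; rewrite -ltz_nat NE; lia.
  have := orth k kle.
  have -> : k%:R + alpha = alpha + 1 + k%:R - 1 by ring.
  rewrite integral_type1_fun// => -[] /eqP.
  by rewrite !mulf_eq0 !(gt_eqF (gamma_fun_gt0 _)) ?(ltr_pwDl s0) ?s0// => /eqP.
Qed.

Lemma is_derive_type1_fun nu alpha A B x : 0 <= nu -> 0 < x ->
  is_derive x 1 (fun y => y `^ alpha * type1_fun nu A B y)
    (x `^ (alpha - 1) *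
     type1_fun nu (deriv_fst nu alpha A B) (deriv_snd alpha A B) x).
Proof.
move=> nu0 x0.
have := is_deriveM (is_derive1_powR alpha x0)
  (is_deriveD (is_deriveM (is_derive_poly A x) (is_derive_rho nu x0))
     (is_deriveM (is_derive_poly B x) (is_derive_rhoS nu0 x0))).
move=> /is_derive_eq; apply.
rewrite /type1_fun /deriv_fst /deriv_snd.
rewrite !(hornerD, hornerN, hornerZ, hornerM, hornerX).
have -> : x `^ alpha = x `^ (alpha - 1) * x.
  by rewrite -[X in _ * X]powRr1 ?ltW// -powRD ?(lt0r_neq0 x0) ?implybT// subrK.
rewrite /GRing.scale /= /type1_fun.
rewrite -[(_ + _) x]/(A.[x] * rho nu x + B.[x] * rho (nu + 1) x).
by field; rewrite gt_eqF.
Qed.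

Lemma type1_funZ nu c A B x :
  type1_fun nu (c *: A) (c *: B) x = c * type1_fun nu A B x.
Proof. by rewrite /type1_fun !hornerZ mulrDr !mulrA. Qed.

(** Multiplication by alpha - X maps the normalized symbol of the index
    (alpha, N) to that of (alpha - 1, N + 1), and the symbol determines the
    pair of polynomials. *)
Lemma is_derive_normalized nu alpha (N : nat) A B A' B' x :
  let P := symbol nu A B in let P' := symbol nu A' B' in
  0 <= nu -> 0 < x ->
  normalizer P *: P = root_prod alpha N ->
  normalizer P' *: P' = root_prod (alpha - 1) N.+1 ->
  is_derive x 1 (fun y => y `^ alpha * (normalizer P * type1_fun nu A B y))
    (x `^ (alpha - 1) * (normalizer P' * type1_fun nu A' B' x)).
Proof.
move=> P P' nu0 x0 PE P'E.
set c := normalizer P in PE *; set c' := normalizer P' in P'E *.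
have scaleP (a : R) X Y : symbol nu (a *: X) (a *: Y) = a *: symbol nu X Y.
  by have := symbol_lincomb nu a 0 X Y 0 0; rewrite !scale0r !addr0.
have [fstE sndE] : c *: deriv_fst nu alpha A B = c' *: A' /\
    c *: deriv_snd alpha A B = c' *: B'.
  apply: (@symbol_inj _ nu).
  by rewrite !scaleP symbol_deriv P'E root_prodS -PE scalerAr.
have := is_deriveZ c (is_derive_type1_fun alpha A B nu0 x0).
have -> : c *: (x `^ (alpha - 1) *
    type1_fun nu (deriv_fst nu alpha A B) (deriv_snd alpha A B) x) =
    x `^ (alpha - 1) * (c' * type1_fun nu A' B' x).
  rewrite -[c' * _]type1_funZ -fstE -sndE type1_funZ.
  by rewrite /GRing.scale /= mulrCA.
set f := (f in is_derive _ _ f _ -> _); set g := (f in _ -> is_derive _ _ f _).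
by rewrite (_ : f = g)//; apply/funext => y; rewrite /f /g /= mulrCA.
Qed.

End Type1.

Theorem theorem2 (R : realType) (nu : R) (hnu : 0 <= nu)
  (A B : R -> nat -> int -> {poly R})
  (hAB : forall (alpha : R) (n : nat) (m : int),
     -1 < alpha -> m = n%:Z \/ m = n%:Z - 1 ->
     is_type1 nu alpha n m (A alpha n m) (B alpha n m)) :
  exists c : R -> nat -> int -> R,
    (forall (alpha : R) (n : nat) (m : int), c alpha n m != 0) /\
    let q (alpha : R) (n : nat) (m : int) (x : R) : R :=
      c alpha n m * type1_fun nu (A alpha n m) (B alpha n m) x in
    forall (alpha : R) (n : nat) (x : R), 0 < alpha -> 0 < x ->
      is_derive x 1 (fun y : R => y `^ alpha * q alpha n n%:Z y)
        (x `^ (alpha - 1) * q (alpha - 1) n.+1 n%:Z x) /\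
      is_derive x 1 (fun y : R => y `^ alpha * q alpha n (n%:Z - 1) y)
        (x `^ (alpha - 1) * q (alpha - 1) n n%:Z x).
Proof.
exists (fun alpha n m =>
  normalizer (symbol nu (A alpha n m) (B alpha n m))); split.
  by move=> alpha n m; exact: normalizer_neq0.
move=> q alpha n x alpha0 x0.
have a1 : -1 < alpha by lra.
have a1' : -1 < alpha - 1 by lra.
have N1 a (k : nat) : -1 < a ->
  normalizer (symbol nu (A a k k%:Z) (B a k k%:Z)) *:
    symbol nu (A a k k%:Z) (B a k k%:Z) = root_prod a (k.*2.+1).
  move=> ha; apply: (type1_symbol (m := k%:Z) (n := k)) => //; [by left|lia|].
  by apply: hAB => //; left.
have N2 a (k : nat) (m : int) : -1 < a -> m = k%:Z - 1 ->
  normalizer (symbol nu (A a k m) (B a k m)) *: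
    symbol nu (A a k m) (B a k m) = root_prod a k.*2.
  move=> ha hm; apply: (type1_symbol (m := m) (n := k)) => //; [by right|lia|].
  by apply: hAB => //; right.
split.
- apply: (is_derive_normalized hnu x0 (N1 _ _ a1)).
  by rewrite (N2 _ n.+1 n%:Z a1') ?doubleS//; lia.
- apply: (is_derive_normalized hnu x0 (N2 _ _ _ a1 _)) => //.
  exact: N1.
Qed.
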